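(* Let $f:B_R\to\mathbb{O}$ be a regular function and let $\alpha\in B_R$. The following statements hold. (1) There exist, and are unique, a regular function $g:B_R\to\mathbb{O}$ and an octonion $r\in\mathbb{O}$ such that $f(w)=((w-\alpha)\ast g)(w)+r$. (2) Suppose that $\alpha$ is non-real. There exist, and are unique, a regular function $h:B_R\to\mathbb{O}$ and octonions $a,b\in\mathbb{O}$ such that $f(w)=(\Delta_\alpha h)(w)+w\,a+b$.
   Context: $\mathbb{O}$ is the real alternative division algebra of octonions (with $\mathbb{R}\subset\mathbb{O}$; an octonion is non-real if it is not in $\mathbb{R}$), $\overline{x}$ is octonionic conjugation, $|x|$ the norm. $B_R$ is the open ball of $\mathbb{O}$ centered at the origin with radius $R\in(0,+\infty]$. A function $f:B_R\to\mathbb{O}$ is (slice) regular if it is given by a power series $f(w)=\sum_{i\ge 0} w^i a_i$ with coefficients $a_i\in\mathbb{O}$ on the right, converging in $B_R$. For regular $f=\sum_i w^ia_i$, $g=\sum_j w^jb_j$ on $B_R$, the product is the regular function $(f\ast g)(w)=\sum_k w^k\big(\sum_{i+j=k}a_ib_j\big)$; when $f$ has real coefficients one writes $fg$ for $f\ast g$. For $\alpha\in\mathbb{O}$ put $t_\alpha=\alpha+\overline\alpha$, $n_\alpha=|\alpha|^2=\alpha\overline\alpha$, and $\Delta_\alpha(w)=(w-\alpha)\ast(w-\overline\alpha)=w^2-w\,t_\alpha+n_\alpha$, a polynomial with real coefficients. *)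

(* Defs.v *)
From HB Require Import structures.
From mathcomp Require Import all_boot all_order all_algebra.
From mathcomp Require Import all_classical all_reals all_analysis.

Set Implicit Arguments.
Unset Strict Implicit.
Unset Printing Implicit Defensive.

Import Order.TTheory GRing.Theory Num.Theory.
Import numFieldNormedType.Exports.

Local Open Scope classical_set_scope.
Local Open Scope ring_scope.

(* Cayley-Dickson doubling: from an algebra A with multiplication [mul] and
   conjugation [conj], the algebra A + A l with
     (a, b)(c, d) = (a c - conj(d) b, d a + b conj(c)),
     conj(a, b) = (conj(a), - b).
   Doubling R three times gives the octonions. *)
Definition cd_mul (A : zmodType) (mul : A -> A -> A) (conj : A -> A)
    (x y : A * A) : A * A :=
  (mul x.1 y.1 - mul (conj y.2) x.2, mul y.2 x.1 + mul x.2 (conj y.1)).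

Definition cd_conj (A : zmodType) (conj : A -> A) (x : A * A) : A * A :=
  (conj x.1, - x.2).

(* Addition, the real vector space structure and the topology of the octonions
   are the ones of the product type.  The product type also carries the
   componentwise ring structure and the sup norm, which are not the octonionic
   product [omul] and the Euclidean norm [onorm]; they must not be used. *)
Definition octonion (R : realType) : Type :=
  (((R * R) * (R * R)) * ((R * R) * (R * R)))%type.

HB.instance Definition _ (R : realType) := NormedModule.copy (octonion R)
  (((R * R) * (R * R)) * ((R * R) * (R * R)))%type.

Definition omul (R : realType) (x y : octonion R) : octonion R :=
  cd_mul (cd_mul (cd_mul *%R id) (cd_conj id)) (cd_conj (cd_conj id)) x y.

Definition oconj (R : realType) (x : octonion R) : octonion R :=
  cd_conj (cd_conj (cd_conj id)) x.

Definition oreal (R : realType) (r : R) : octonion R :=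
  (((r, 0), (0, 0)), ((0, 0), (0, 0))).

Definition onorm (R : realType) (x : octonion R) : R :=
  let nsq2 (u : R * R) := u.1 ^+ 2 + u.2 ^+ 2 in
  let nsq4 (u : (R * R) * (R * R)) := nsq2 u.1 + nsq2 u.2 in
  Num.sqrt (nsq4 x.1 + nsq4 x.2).

Notation "x *o y" := (omul x y) (at level 40, left associativity) : ring_scope.

Fixpoint opow (R : realType) (w : octonion R) (n : nat) : octonion R :=
  if n is m.+1 then w *o opow w m else oreal 1.

Definition oball (R : realType) (rho : \bar R) : set (octonion R) :=
  [set w | ((onorm w)%:E < rho)%E].

Section Regular.
Context (R : realType) (rho : \bar R).
Implicit Types (f g : oball rho -> octonion R) (a b : nat -> octonion R).

Definition has_coefs f a : Prop :=
  forall w : oball rho,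
    series (fun i => opow (val w) i *o a i) n @[n --> \oo] --> f w.

Definition regular f : Prop := exists a, has_coefs f a.

(* For a regular function on a ball of positive radius the coefficient sequence
   is unique, so that the choice made by [get] is immaterial. *)
Definition coefs f : nat -> octonion R := get (has_coefs f).

Definition star f g : oball rho -> octonion R := fun w =>
  limn (series (fun k =>
    opow (val w) k *o \sum_(i < k.+1) (coefs f i *o coefs g (k - i)%N))).

Definition linear_factor (alpha : octonion R) : oball rho -> octonion R :=
  fun w => val w - alpha.

Definition Delta (alpha : octonion R) : oball rho -> octonion R :=
  star (linear_factor alpha) (linear_factor (oconj alpha)).

End Regular.

(* Main.v *)
(** Comparing coefficients, [f = (w - alpha) * g + r] reads
    [a_k = b_(k-1) - alpha b_k] for [k > 0], with a free value at [k = 0].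
    Its solution is [b_k = sum_j alpha^j a_(k+1+j)], which converges and has the
    right growth because [|alpha|] is less than the radius.  A second solution
    would differ by a sequence with [d_m = alpha^n d_(m+n)] for all [n], and
    the right-hand side tends to [0].
    Dividing by [w - alpha] and then by [w - conj alpha] divides by the
    quadratic polynomial, since [alpha (conj alpha x) = (alpha conj alpha) x].
    Associativity is otherwise never used: only multiplicativity of the norm. *)

Require Import Defs.
From HB Require Import structures.
From mathcomp Require Import all_boot all_order all_algebra.
From mathcomp Require Import all_classical all_reals all_analysis.
From mathcomp Require Import ring lra.

Set Implicit Arguments.
Unset Strict Implicit.
Unset Printing Implicit Defensive.

Import Order.TTheory GRing.Theory Num.Theory.
Import numFieldNormedType.Exports.

Local Open Scope classical_set_scope.
Local Open Scope ring_scope.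

(** * Octonion identities and the comparison of the two norms *)

Section OctonionAlgebra.
Context (R : realType).
Implicit Types (w x y z : octonion R) (s : R).

(** The square of [onorm], polynomial in the coordinates, so that [ring] can prove identities about
    it. *)
Definition osq x : R :=
  let nsq2 (u : R * R) := u.1 ^+ 2 + u.2 ^+ 2 in
  let nsq4 (u : (R * R) * (R * R)) := nsq2 u.1 + nsq2 u.2 in
  nsq4 x.1 + nsq4 x.2.

Ltac oct_coords x :=
  let x1 := fresh x in let x2 := fresh x in let x3 := fresh x in
  let x4 := fresh x in let x5 := fresh x in let x6 := fresh x in
  let x7 := fresh x in let x8 := fresh x in
  case: x => [[[x1 x2] [x3 x4]] [[x5 x6] [x7 x8]]].

Ltac oct_ring :=
  rewrite /omul /oconj /cd_mul /cd_conj /=;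
  congr (((_, _), (_, _)), ((_, _), (_, _))) => /=; ring.

Lemma omulDr x y z : x *o (y + z) = x *o y + x *o z.
Proof. oct_coords x; oct_coords y; oct_coords z; oct_ring. Qed.

Lemma omulDl x y z : (x + y) *o z = x *o z + y *o z.
Proof. oct_coords x; oct_coords y; oct_coords z; oct_ring. Qed.

Lemma omulNr x y : x *o (- y) = - (x *o y).
Proof. oct_coords x; oct_coords y; oct_ring. Qed.

Lemma omulNl x y : (- x) *o y = - (x *o y).
Proof. oct_coords x; oct_coords y; oct_ring. Qed.

Lemma oreal_mul s x : oreal s *o x = s *: x.
Proof.
oct_coords x; rewrite /omul /cd_mul /cd_conj /=.
congr (((_, _), (_, _)), ((_, _), (_, _)));
  (* The scalar action on [R] is turned into a product, which [ring] understands. *)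
  rewrite /= -[RHS]/(s * _); ring.
Qed.

Lemma omulo1 x : x *o oreal 1 = x.
Proof. oct_coords x; rewrite /oreal; oct_ring. Qed.

Lemma omul_oconj x : x *o oconj x = oreal (osq x).
Proof. oct_coords x; rewrite /osq /oreal; oct_ring. Qed.

(** A case of alternativity, as [oconj x] is a real octonion minus [x]. Both sides are [osq x] times
    [y]. *)
Lemma omul_oconjA x y : (x *o oconj x) *o y = x *o (oconj x *o y).
Proof.
rewrite omul_oconj oreal_mul; oct_coords x; oct_coords y.
rewrite /osq /oconj /cd_conj /= [X in _ = _ *o X]/omul /cd_mul /cd_conj /=.
rewrite /omul /cd_mul /cd_conj /=.
congr (((_, _), (_, _)), ((_, _), (_, _)));
  rewrite /= -[LHS]/((_ + _) * _); ring.
Qed.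

(** Degen's eight-square identity, which makes [onorm] multiplicative. *)
Lemma osqM x y : osq (x *o y) = osq x * osq y.
Proof.
oct_coords x; oct_coords y.
rewrite /osq /omul /cd_mul /cd_conj /=; ring.
Qed.

Lemma osq_ge0 x : 0 <= osq x.
Proof. by rewrite !addr_ge0 ?sqr_ge0. Qed.

Lemma onormE x : onorm x = Num.sqrt (osq x). Proof. by []. Qed.

Lemma onorm_ge0 x : 0 <= onorm x. Proof. exact: sqrtr_ge0. Qed.

Lemma onormM x y : onorm (x *o y) = onorm x * onorm y.
Proof. by rewrite !onormE osqM sqrtrM ?osq_ge0. Qed.

Lemma onorm_oconj x : onorm (oconj x) = onorm x.
Proof.
by oct_coords x; rewrite !onormE /osq /oconj /cd_conj /= !sqrrN.
Qed.

Lemma onorm_oreal s : onorm (oreal s) = `|s|.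
Proof. by rewrite onormE /osq /= expr0n /= !addr0 sqrtr_sqr. Qed.

Lemma onorm_opow w n : onorm (opow w n) = onorm w ^+ n.
Proof.
elim: n => [|n IH] /=; first by rewrite onorm_oreal normr1.
by rewrite onormM IH exprS.
Qed.

Lemma opow_oreal s n : opow (oreal s) n = oreal (s ^+ n).
Proof.
elim: n => [|n IH] //=.
rewrite IH oreal_mul exprS.
congr (((_, _), (_, _)), ((_, _), (_, _))); exact: mulr0.
Qed.

Lemma oct_normE x : `|x| =
  Num.max (Num.max (Num.max `|x.1.1.1| `|x.1.1.2|) (Num.max `|x.1.2.1| `|x.1.2.2|))
   (Num.max (Num.max `|x.2.1.1| `|x.2.1.2|) (Num.max `|x.2.2.1| `|x.2.2.2|)).
Proof. by []. Qed.

Lemma norm_le_onorm x : `|x| <= onorm x.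
Proof.
have le_sqrt (c s : R) : c ^+ 2 <= s -> `|c| <= Num.sqrt s.
  by move=> cs; rewrite -sqrtr_sqr ler_wsqrtr.
rewrite oct_normE onormE !ge_max -!andbA.
oct_coords x; rewrite /osq /=.
have := (sqr_ge0 x0, sqr_ge0 x1, sqr_ge0 x2, sqr_ge0 x3,
  (sqr_ge0 x4, sqr_ge0 x5, sqr_ge0 x6, sqr_ge0 x7)).
move=> -[[[[? ?] ?] ?] [[[? ?] ?] ?]].
by do ![apply/andP; split]; apply: le_sqrt; lra.
Qed.

(* [`|x|] is the sup norm of the product type; the constant is not sharp. *)
Lemma onorm_le_norm x : onorm x <= 8 * `|x|.
Proof.
have := lexx `|x|; rewrite {1}oct_normE !ge_max -!andbA.
set M := `|x| => H.
have M0 : 0 <= M by exact: normr_ge0.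
have le_sq (c : R) : `|c| <= M -> c ^+ 2 <= M ^+ 2.
  by move=> cM; rewrite -[c ^+ 2]real_normK ?num_real// ler_sqr ?nnegrE.
rewrite onormE -[leRHS]ger0_norm ?mulr_ge0// -sqrtr_sqr ler_wsqrtr//.
move: H => /and5P[h1 h2 h3 h4 /and4P[h5 h6 h7 h8]].
have := (le_sq _ h1, le_sq _ h2, le_sq _ h3, le_sq _ h4,
  (le_sq _ h5, le_sq _ h6, le_sq _ h7, le_sq _ h8)).
rewrite /osq exprMn => -[[[[l1 l2] l3] l4] [[[l5 l6] l7] l8]].
have := sqr_ge0 M; lra.
Qed.

End OctonionAlgebra.

(** * Absolutely convergent series of octonions *)

Section AbsoluteConvergence.
Context (R : realType).

(** Completeness phrased through series, a form that passes to products one component at a time. *)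
Definition abs_complete (V : normedModType R) : Prop :=
  forall u : nat -> V, cvgn (series (fun n => `|u n|)) -> cvgn (series u).

Lemma abs_complete_prod (U V : normedModType R) :
  abs_complete U -> abs_complete V -> abs_complete (U * V)%type.
Proof.
move=> cU cV u cu.
have c1 : cvgn (series (fun n => (u n).1)).
  apply: cU; apply: series_le_cvg cu => n //=.
  by rewrite prod_normE le_max lexx.
have c2 : cvgn (series (fun n => (u n).2)).
  apply: cV; apply: series_le_cvg cu => n //=.
  by rewrite prod_normE le_max lexx orbT.
have -> : series u = fun n =>
    (series (fun n => (u n).1) n, series (fun n => (u n).2) n).
  apply/funext => n; elim: n => [|n IH]; first by rewrite /series /= !big_geq.
  by rewrite !seriesS IH; case: (u n).
apply/cvg_ex.
exists (limn (series (fun n => (u n).1)), limn (series (fun n => (u n).2))).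
exact: cvg_pair.
Qed.

Lemma oct_complete : abs_complete (octonion R).
Proof.
have cR : abs_complete R by move=> u; exact: normed_cvg.
by do 3!apply: abs_complete_prod.
Qed.

End AbsoluteConvergence.

(** * Growth of the coefficients and convergence on the ball *)

Section Coefs.
Context (R : realType) (rho : \bar R).
Implicit Types (f : oball rho -> octonion R) (w : octonion R).
Implicit Types (a : nat -> octonion R) (s r : R).

(** Leaves room for a geometric ratio below 1, for finite and infinite radius alike. *)
Lemma real_between r : (r%:E < rho)%E -> exists2 s, r < s & (s%:E < rho)%E.
Proof.
case: rho => [t| |]; rewrite ?lte_fin ?ltry ?ltNge ?leNye//.
  by move=> rt; exists ((r + t) / 2); rewrite ?lte_fin; lra.
by move=> _; exists (r + 1); rewrite ?ltry// ltrDl.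
Qed.

(* Exactly the coefficient sequences of the regular functions on [oball rho],
   by [has_coefs_admissible] and [admissible_has_coefs]. *)
Definition admissible a := forall s, 0 < s -> (s%:E < rho)%E ->
  exists M, forall k, `|a k| * s ^+ k <= M.

(** Abel's lemma: for [s] strictly between [onorm w] and [rho] the terms are at most
    [8 * M * (onorm w / s) ^+ k]. The 8 comes from [onorm_le_norm]. *)
Lemma admissible_cvg a w : admissible a -> oball rho w ->
  cvgn (series (fun k => opow w k *o a k)).
Proof.
move=> adm_a w_in; apply: oct_complete.
have [s ws srho] := real_between w_in.
have s0 : 0 < s by apply: le_lt_trans ws; exact: onorm_ge0.
have [M aM] := adm_a _ s0 srho.
have q1 : `|onorm w / s| < 1.
  by rewrite ger0_norm ?divr_ge0 ?onorm_ge0 ?ltW// ltr_pdivrMr ?mul1r.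
apply: series_le_cvg (is_cvg_geometric_series (a := 8 * M) q1) => [k|k|k] //=.
  rewrite mulr_ge0 ?exprn_ge0 ?divr_ge0 ?onorm_ge0 ?(ltW s0) ?mulr_ge0//.
  by apply: le_trans (aM 0%N); rewrite mulr1.
apply: (le_trans (norm_le_onorm _)); rewrite onormM onorm_opow.
rewrite expr_div_n mulrCA mulrA ler_pdivlMr ?exprn_gt0//.
rewrite -mulrA ler_wpM2l ?exprn_ge0 ?onorm_ge0//.
apply: (le_trans (ler_wpM2r _ (onorm_le_norm _))); first by rewrite exprn_ge0 ?ltW.
by rewrite -mulrA ler_wpM2l.
Qed.

Lemma oball_oreal s : 0 <= s -> (s%:E < rho)%E ->
  exists w : oball rho, val w = oreal s.
Proof.
move=> s0 sr; suff s_in : oreal s \in oball rho by exists (SigSub s_in).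
by rewrite inE /oball /= onorm_oreal ger0_norm.
Qed.

(** At a real point the powers of [w] are real scalars. Growth and uniqueness of the coefficients
    are both read off at such points. *)
Lemma has_coefs_oreal f a s (w : oball rho) : has_coefs f a -> val w = oreal s ->
  series (fun k => s ^+ k *: a k) n @[n --> \oo] --> f w.
Proof.
move=> fa ws; suff -> : (fun k => s ^+ k *: a k) = (fun k => opow (val w) k *o a k).
  exact: fa.
by apply/funext => k; rewrite ws opow_oreal oreal_mul.
Qed.

Lemma cvg_series_bound (V : normedModType R) (u : nat -> V) :
  cvgn (series u) -> exists M, forall k, `|u k| <= M.
Proof.
move=> cu; have c0 : cvgn u by apply/cvg_ex; exists 0; exact: cvg_series_cvg_0.
have [M [_ uM]] := cvg_seq_bounded c0.
by exists (M + 1) => k; apply: (uM (M + 1)) => //; rewrite ltrDl.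
Qed.

Lemma has_coefs_admissible f a : has_coefs f a -> admissible a.
Proof.
move=> fa s s0 srho.
have [w ws] := oball_oreal (ltW s0) srho.
have [] := @cvg_series_bound _ (fun k => s ^+ k *: a k).
  exact: cvgP (has_coefs_oreal fa ws).
move=> M aM; exists M => k; apply: le_trans (aM k).
by rewrite normrZ ger0_norm ?exprn_ge0 ?(ltW s0)// mulrC.
Qed.

Lemma admissible_has_coefs a : admissible a -> exists f, has_coefs f a.
Proof.
move=> adm_a.
exists (fun w : oball rho => limn (series (fun k => opow (val w) k *o a k))) => w.
by apply: admissible_cvg => //; have := valP w; rewrite inE.
Qed.

End Coefs.

(** * Power series vanishing on a real interval *)

Section PowerSeries.
Context (R : realType) (V : normedModType R).
Implicit Types (d : nat -> V) (s : R).

(** At [s0 * q] with [q <= 1/2], the terms after the first add up to at most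
    [M * q / (1 - q) <= 2 * (M * q)]. The first term must cancel them, so it is arbitrarily
    small. *)
Lemma pseries0_coef0 d s0 : 0 < s0 ->
  (forall s, 0 < s <= s0 -> series (fun k => s ^+ k *: d k) n @[n --> \oo] --> 0) ->
  d 0%N = 0.
Proof.
move=> s0_gt0 d0.
have [] := @cvg_series_bound R V (fun k => s0 ^+ k *: d k).
  by apply/cvg_ex; exists 0; apply: d0; rewrite s0_gt0 lexx.
move=> M dM.
have d0M : `|d 0%N| <= M by have := dM 0%N; rewrite expr0 scale1r.
have small q : 0 < q <= 2^-1 -> `|d 0%N| <= 2 * (M * q).
  move=> /andP[q0 q2].
  have q1 : q < 1 by lra.
  have sq : 0 < s0 * q <= s0 by rewrite mulr_gt0//= ger_pMr ?ltW.
  have := d0 _ sq; rewrite -cvg_shiftS => /(cvgB (cvg_cst (d 0%N))) /cvg_norm.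
  rewrite subr0 => /cvgr_to_le; apply; apply: nearW => n.
  rewrite /series !fctE /= big_nat_recl// expr0 scale1r.
  rewrite opprD addrA subrr add0r normrN.
  apply: (le_trans (ler_norm_sum _ _ _)).
  have Mq : M * q / (1 - q) <= 2 * (M * q).
    rewrite ler_pdivrMr; last by lra.
    have : 0 <= M * q by rewrite mulr_ge0 ?(le_trans _ d0M)// ltW.
    nra.
  apply: le_trans Mq; apply: le_trans (geometric_le_lim n _ _ _) => //; last 2 first.
  - by rewrite mulr_ge0 ?(le_trans _ d0M)// ltW.
  - by rewrite ger0_norm// ltW.
  apply: ler_sum => k _; rewrite exprMn mulrC -scalerA normrZ ger0_norm; last first.
    by rewrite exprn_ge0 ?ltW.
  by rewrite /geometric /= -[leRHS]mulrA -exprS mulrC ler_pM2r// exprn_gt0.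
have [//|d00] := eqVneq (d 0%N) 0; exfalso.
have d0_gt0 : 0 < `|d 0%N| by rewrite normr_gt0.
have M0 : 0 < M by exact: lt_le_trans d0M.
(* This [q] turns the bound into half of the norm of [d 0]; it is at most 1/2 because that norm is
   at most [M]. *)
have := small (`|d 0%N| / (4 * M)).
have -> : 2 * (M * (`|d 0%N| / (4 * M))) = `|d 0%N| / 2 by field; lra.
rewrite divr_gt0 ?mulr_gt0//= ler_pdivrMr ?mulr_gt0//.
have -> : 2^-1 * (4 * M) = 2 * M by field.
move=> H; suff /H : `|d 0%N| <= 2 * M by lra.
lra.
Qed.

(** Once the constant term is known to vanish, division by [s] shifts the coefficients and keeps the
    sum 0. This is why only positive [s] are considered. *)
Lemma pseries0_coefs d s0 : 0 < s0 ->
  (forall s, 0 < s <= s0 -> series (fun k => s ^+ k *: d k) n @[n --> \oo] --> 0) ->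
  forall m, d m = 0.
Proof.
move=> s0_gt0 d0 m; elim: m d d0 => [|m IH] d d0.
  exact: pseries0_coef0 d0.
apply: (IH (fun k => d k.+1)) => s s_in.
have s_neq0 : s != 0 by rewrite gt_eqF//; case/andP: s_in.
have d00 := pseries0_coef0 s0_gt0 d0.
have := d0 _ s_in; rewrite -cvg_shiftS => /(cvgZl_tmp (k := s^-1)).
rewrite scaler0.
suff <- : series (fun k => s ^+ k *: d k.+1) =
    s^-1 \*: (fun n => series (fun k => s ^+ k *: d k) n.+1) by [].
apply/funext => n; rewrite /series /= big_nat_recl// d00 scaler0 add0r scaler_sumr.
by apply: eq_bigr => k _; rewrite scalerA exprS mulKf.
Qed.

End PowerSeries.

(** * Uniqueness of the coefficients of a regular function *)

Section Uniqueness.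
Context (R : realType) (rho : \bar R) (rho_gt0 : (0 < rho)%E).
Implicit Types (f : oball rho -> octonion R) (a b : nat -> octonion R).

Lemma has_coefs_unique f a b : has_coefs f a -> has_coefs f b -> a = b.
Proof.
move=> fa fb.
have [s0 s0_gt0 s0rho] := real_between rho_gt0.
apply/funext => k; apply/subr0_eq.
apply: (@pseries0_coefs _ _ (fun k => a k - b k) s0) => // s /andP[sgt0 ss0].
have srho : (s%:E < rho)%E by apply: le_lt_trans s0rho; rewrite lee_fin.
have [w ws] := oball_oreal (ltW sgt0) srho.
have := cvgB (has_coefs_oreal fa ws) (has_coefs_oreal fb ws).
rewrite subrr => ab.
suff -> : series (fun k => s ^+ k *: (a k - b k)) =
    series (fun k => s ^+ k *: a k) - series (fun k => s ^+ k *: b k) by exact: ab.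
apply/funext => n; rewrite /series !fctE /= -sumrB.
by apply: eq_bigr => j _; rewrite scalerBr.
Qed.

Lemma coefsE f a : has_coefs f a -> coefs f = a.
Proof.
move=> fa; have : exists b, has_coefs f b by exists a.
by move/getPex => fb; exact: has_coefs_unique fb fa.
Qed.

Lemma has_coefs_fun_unique f g a : has_coefs f a -> has_coefs g a -> f = g.
Proof.
move=> fa ga; apply/funext => w.
rewrite -(cvg_lim (@norm_hausdorff _ _) (fa w)).
by rewrite -(cvg_lim (@norm_hausdorff _ _) (ga w)).
Qed.

End Uniqueness.

(** * Continuity of left multiplication *)

Section OctonionLimits.
Context (R : realType).
Implicit Types (x y : octonion R).

Lemma omulo0 x : x *o 0 = 0.
Proof. by apply: (addrI (x *o 0)); rewrite -omulDr !addr0. Qed.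

Lemma omul0o x : 0 *o x = 0.
Proof. by apply: (addrI (0 *o x)); rewrite -omulDl !addr0. Qed.

Lemma omulBr x y z : x *o (y - z) = x *o y - x *o z.
Proof. by rewrite omulDr omulNr. Qed.

Lemma omul_sumr x n (u : nat -> octonion R) :
  x *o \sum_(0 <= k < n) u k = \sum_(0 <= k < n) x *o u k.
Proof. by apply: (big_morph (omul x)) => [y z|]; rewrite ?omulDr ?omulo0. Qed.

Lemma norm_omul x y : `|x *o y| <= 8 * onorm x * `|y|.
Proof.
apply: (le_trans (norm_le_onorm _)).
by rewrite onormM mulrAC [leLHS]mulrC ler_wpM2r ?onorm_ge0// onorm_le_norm.
Qed.

Lemma onorm_eq0 x : onorm x = 0 -> x = 0.
Proof.
by move=> x0; apply/normr0_eq0/le_anti; rewrite normr_ge0 -x0 norm_le_onorm.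
Qed.

Lemma cvg_omulr x y (u : nat -> octonion R) :
  u n @[n --> \oo] --> y -> x *o u n @[n --> \oo] --> x *o y.
Proof.
move=> uy; apply/cvgrPdist_le => e e0.
(* The summand 1 keeps the constant positive when [x] is 0. *)
have K0 : 0 < 8 * onorm x + 1 by rewrite ltr_wpDl// mulr_ge0 ?onorm_ge0.
have /cvgrPdist_le/(_ (e / (8 * onorm x + 1))) := uy.
rewrite divr_gt0// => /(_ isT); apply: filterS => n.
rewrite ler_pdivlMr// => un; rewrite -omulBr; apply: le_trans (norm_omul _ _) _.
by apply: le_trans un; rewrite [leRHS]mulrC ler_wpM2r// lerDl.
Qed.

End OctonionLimits.

(** * Division by a linear factor on coefficient sequences *)

Section Division.
Context (R : realType) (rho : \bar R).
Implicit Types (al x : octonion R) (a b : nat -> octonion R) (s r : R).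

Definition monomial_coefs (j : nat) x (k : nat) : octonion R := if k == j then x else 0.

(* Coefficients of [(w - al) * g], where [b] are those of [g]. *)
Definition linmul al b (k : nat) : octonion R :=
  (if k is m.+1 then b m else 0) - al *o b k.

Lemma admissibleB a b :
  admissible rho a -> admissible rho b -> admissible rho (a - b).
Proof.
move=> adm_a adm_b s s0 srho.
have [M aM] := adm_a s s0 srho; have [N bN] := adm_b s s0 srho.
exists (M + N) => k; apply: le_trans (lerD (aM k) (bN k)).
by rewrite -mulrDl ler_wpM2r ?exprn_ge0 ?(ltW s0)// !fctE ler_normB.
Qed.

Lemma admissible_linmul al b : admissible rho b -> admissible rho (linmul al b).
Proof.
move=> adm_b s s0 srho; have [M bM] := adm_b s s0 srho.
have M0 : 0 <= M by apply: le_trans (bM 0%N); rewrite mulr1.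
(* The shift costs a factor [s], the product with [al] a factor [8 * onorm al]. *)
exists (M * s + 8 * onorm al * M) => k.
apply: (@le_trans _ _ ((`|if k is m.+1 then b m else 0| + `|al *o b k|) * s ^+ k)).
  by rewrite ler_wpM2r ?exprn_ge0 ?(ltW s0)// ler_normB.
rewrite mulrDl lerD//.
  case: k => [|k]; first by rewrite normr0 mul0r mulr_ge0// ltW.
  by rewrite exprSr mulrA ler_wpM2r// ltW.
have := ler_wpM2r (exprn_ge0 k (ltW s0)) (norm_omul al (b k)).
move=> /le_trans; apply; rewrite -[leLHS]mulrA ler_wpM2l// mulr_ge0 ?onorm_ge0//.
Qed.

(** Nested products [al *o (al *o ...)] play the role of a power of [al] times [x], so that nothing
    has to be rebracketed. *)
Lemma onorm_iter_omul al n x : onorm (iter n (omul al) x) = onorm al ^+ n * onorm x.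
Proof.
by elim: n => [|n IH]; rewrite /= ?mul1r// onormM IH exprS mulrA.
Qed.

(** Iterating [b m = al *o b m.+1] bounds [onorm (b m)] by a fixed multiple of [(onorm al / s) ^+ n]
    for every [n]. Index 0 is left out because a remainder can alter it. *)
Lemma linmul_eq0 al b : oball rho al -> admissible rho b ->
  (forall k, linmul al b k.+1 = 0) -> b = 0.
Proof.
move=> al_in adm_b lin0; apply/funext => m.
have bE n : b m = iter n (omul al) (b (m + n)%N).
  elim: n => [|n ->]; first by rewrite addn0.
  by rewrite iterSr addnS; congr iter; apply/subr0_eq/lin0.
have [s als srho] := real_between al_in.
have s0 : 0 < s by apply: le_lt_trans als; exact: onorm_ge0.
have [M bM] := adm_b s s0 srho.
have q1 : `|onorm al / s| < 1.
  by rewrite ger0_norm ?divr_ge0 ?onorm_ge0 ?(ltW s0)// ltr_pdivrMr ?mul1r.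
apply/onorm_eq0/le_anti; rewrite onorm_ge0 andbT.
have /cvgr_to_ge := cvg_geometric (8 * M / s ^+ m) q1; apply.
apply: nearW => n; rewrite (bE n) onorm_iter_omul /geometric /=.
rewrite expr_div_n mulrCA ler_wpM2l ?exprn_ge0 ?onorm_ge0//.
apply: (le_trans (onorm_le_norm _)).
rewrite -[leRHS]mulrA -[leRHS]mulrA -invfM -exprD ler_wpM2l// ler_pdivlMr ?exprn_gt0//.
Qed.

Lemma linmul_div al a : oball rho al -> admissible rho a ->
  exists b x, admissible rho b /\ a = linmul al b + monomial_coefs 0 x.
Proof.
move=> al_in adm_a.
(* The [j]-th term of the series for the quotient coefficient of index [k]. *)
pose u k j := iter j (omul al) (a (k.+1 + j)%N).
have uM s s1 M k j : 0 < s -> onorm al <= s1 -> (forall k, `|a k| * s ^+ k <= M) ->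
    `|u k j| <= geometric (8 * M / s ^+ k.+1) (s1 / s) j.
  move=> s0 als1 aM; apply: (le_trans (norm_le_onorm _)).
  rewrite onorm_iter_omul /geometric /= expr_div_n mulrCA.
  apply: ler_pM; rewrite ?exprn_ge0 ?onorm_ge0//.
    by apply: lerXn2r; rewrite ?nnegrE ?onorm_ge0 ?(le_trans _ als1)// onorm_ge0.
  apply: (le_trans (onorm_le_norm _)).
  by rewrite -[leRHS]mulrA -[leRHS]mulrA -invfM -exprD ler_wpM2l// ler_pdivlMr ?exprn_gt0.
(* [s1] replaces [onorm al] to keep the ratio [s1 / s] positive even when [al] is 0. *)
have u_bound s s1 : 0 < s1 -> onorm al <= s1 -> s1 < s -> (s%:E < rho)%E ->
   exists M, forall k, cvgn (series (u k)) /\ `|limn (series (u k))| * s ^+ k <= M.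
  move=> s1_gt0 als1 s1s srho; have s0 : 0 < s by exact: lt_trans s1s.
  have [M aM] := adm_a s s0 srho.
  have M0 : 0 <= M by apply: le_trans (aM 0%N); rewrite mulr1.
  have q0 : 0 < s1 / s by rewrite divr_gt0.
  have q1 : `|s1 / s| < 1 by rewrite gtr0_norm// ltr_pdivrMr ?mul1r.
  (* The geometric sum times [s ^+ k]; the powers of [s] cancel, so the bound is uniform in [k]. *)
  exists (8 * M / s / (1 - s1 / s)) => k.
  have C0 : 0 <= 8 * M / s ^+ k.+1 by rewrite !mulr_ge0// invr_ge0 exprn_ge0 ?(ltW s0).
  have cu : cvgn (series (u k)).
    apply: oct_complete.
    apply: series_le_cvg (is_cvg_geometric_series (a := 8 * M / s ^+ k.+1) q1) => j //=.
      by rewrite mulr_ge0// exprn_ge0 ?(ltW q0).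
    exact: uM.
  split=> //.
  have -> : 8 * M / s / (1 - s1 / s) = 8 * M / s ^+ k.+1 / (1 - s1 / s) * s ^+ k.
    rewrite exprS; field.
    by rewrite subr_eq0 !gt_eqF//= ?exprn_gt0//; move: q1; rewrite gtr0_norm// => /gt_eqF ->.
  rewrite ler_wpM2r ?exprn_ge0 ?(ltW s0)//.
  have /cvg_norm /cvgr_to_le := cu; apply; apply: nearW => n.
  apply: le_trans (geometric_le_lim n C0 q0 q1).
  by apply: (le_trans (ler_norm_sum _ _ _)); apply: ler_sum => j _; exact: uM.
pose b k := limn (series (u k)).
have adm_b : admissible rho b.
  move=> s s0 srho.
  (* A test radius [s] below [onorm al] gives no convergent majorant, so the estimate is made at a
     larger radius and then weakened. *)
  have [s2 s12 s2rho] : exists2 s2, Num.max s (onorm al) < s2 & (s2%:E < rho)%E.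
    by apply: real_between; rewrite /Num.max; case: ifP.
  have [] := u_bound s2 (Num.max s (onorm al)) => //.
  - by rewrite lt_max s0.
  - by rewrite le_max lexx orbT.
  move=> M bM; exists M => k; apply: le_trans (bM k).2.
  rewrite ler_wpM2l// lerXn2r ?nnegrE ?(ltW s0)//; apply/ltW.
  - by apply: lt_trans s12; rewrite lt_max s0.
  - by apply: le_lt_trans s12; rewrite le_max lexx.
have cu k : cvgn (series (u k)).
  have [s1 als1 s1rho] := real_between al_in.
  have [s s1s srho] := real_between s1rho.
  have s1_gt0 : 0 < s1 by apply: le_lt_trans als1; exact: onorm_ge0.
  by have [M /(_ k)[]] := u_bound s s1 s1_gt0 (ltW als1) s1s srho.
(* The first term of the series is split off; the others have a common left factor [al], which
   commutes with the limit. *)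
have bE k : b k = a k.+1 + al *o b k.+1.
  apply: (cvg_lim (@norm_hausdorff _ _)); rewrite -cvg_shiftS.
  suff -> : (fun n => series (u k) n.+1) = (fun n => a k.+1 + al *o series (u k.+1) n).
    by apply: cvgD; [exact: cvg_cst|apply: cvg_omulr; exact: cu].
  apply/funext => n; rewrite /series /= big_nat_recl// omul_sumr /u addn0.
  by congr (_ + _); apply: eq_bigr => j _; rewrite iterS addnS.
(* The remainder is dictated by the coefficient of index 0. *)
exists b, (a 0%N + al *o b 0%N); split=> //; apply/funext => -[|k].
  by rewrite !fctE /linmul /monomial_coefs /= sub0r addrC addrK.
by rewrite !fctE /linmul /monomial_coefs /= addr0 bE addrK.
Qed.

End Division.

(** * Coefficients of star products and of the division identities *)

Section Star.
Context (R : realType) (rho : \bar R) (rho_gt0 : (0 < rho)%E).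
Implicit Types (f g h : oball rho -> octonion R) (al x y : octonion R).
Implicit Types (a b c : nat -> octonion R).

Lemma has_coefsD f g a b : has_coefs f a -> has_coefs g b ->
  has_coefs (fun w => f w + g w) (a + b).
Proof.
move=> fa gb w; have fg := cvgD (fa w) (gb w).
suff -> : series (fun k => opow (val w) k *o (a + b) k) =
   series (fun k => opow (val w) k *o a k) + series (fun k => opow (val w) k *o b k).
  exact: fg.
apply/funext => n; rewrite /series !fctE /= -big_split /=.
by apply: eq_bigr => k _; rewrite omulDr.
Qed.

Lemma has_coefs_monomial j x :
  has_coefs (fun w : oball rho => opow (val w) j *o x) (monomial_coefs j x).
Proof.
move=> w; apply: cvg_near_cst; near=> n.
transitivity (\sum_(0 <= k < n | k == j) opow (val w) k *o x).
  rewrite [RHS]big_mkcond; apply: eq_bigr => k _.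
  by rewrite /monomial_coefs; case: ifP; rewrite ?omulo0.
rewrite big_nat1_eq /=; suff -> : (j < n)%N by [].
by near: n; exact: nbhs_infty_gt.
Unshelve. all: by end_near. Qed.

Lemma has_coefs_cst x : has_coefs (fun _ : oball rho => x) (monomial_coefs 0 x).
Proof.
by have := @has_coefs_monomial 0 x; rewrite /= oreal_mul scale1r.
Qed.

Lemma has_coefs_linear x :
  has_coefs (fun w : oball rho => val w *o x) (monomial_coefs 1 x).
Proof.
suff -> : (fun w : oball rho => val w *o x) = (fun w => opow (val w) 1 *o x).
  exact: has_coefs_monomial.
by apply/funext => w; rewrite /= omulo1.
Qed.

Definition linear_coefs al := monomial_coefs 1 (oreal 1) + monomial_coefs 0 (- al).

Lemma has_coefs_linear_factor al :
  has_coefs (@linear_factor R rho al) (linear_coefs al).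
Proof.
suff -> : linear_factor al = fun w : oball rho => val w *o oreal 1 + - al.
  exact: has_coefsD (@has_coefs_linear (oreal 1)) (@has_coefs_cst (- al)).
by apply/funext => w; rewrite omulo1.
Qed.

Lemma oreal1_mul x : oreal 1 *o x = x. Proof. by rewrite oreal_mul scale1r. Qed.

(** Convergence is checked on a closed form [c] of the coefficients, in place of an estimate for
    Cauchy products. *)
Lemma star_coefs f g a b c : has_coefs f a -> has_coefs g b ->
  admissible rho c ->
  (forall k, c k = \sum_(i < k.+1) (a i *o b (k - i)%N)) ->
  has_coefs (star f g) c.
Proof.
move=> fa gb adm_c cE w.
rewrite /star (coefsE rho_gt0 fa) (coefsE rho_gt0 gb).
have -> : (fun k => opow (val w) k *o \sum_(i < k.+1) (a i *o b (k - i)%N)) =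
  (fun k => opow (val w) k *o c k) by apply/funext => k; rewrite cE.
by apply: (admissible_cvg adm_c); have := valP w; rewrite inE.
Qed.

Lemma star_linear al g b : has_coefs g b ->
  has_coefs (star (linear_factor al) g) (linmul al b).
Proof.
move=> gb; apply: (star_coefs (@has_coefs_linear_factor al) gb).
  exact/admissible_linmul/(has_coefs_admissible gb).
move=> [|k]; rewrite /linmul /linear_coefs big_ord_recl /= !fctE /monomial_coefs /=.
  by rewrite big_ord0 addr0 !add0r omulNl.
rewrite big_ord_recl /= big1 => [|i _]; last by rewrite addr0 omul0o.
by rewrite !addr0 add0r oreal1_mul omulNl addrC /bump /= subn0 subn1.
Qed.

Lemma Delta_coefs al :
  has_coefs (@Delta R rho al) (linmul al (linear_coefs (oconj al))).
Proof. exact/star_linear/has_coefs_linear_factor. Qed.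

(** Turns division by the quadratic into two linear divisions. Each Cauchy sum has at most three
    non-zero terms, and only the one with [al *o oconj al] needs rebracketing. *)
Lemma star_Delta al h c : has_coefs h c ->
  has_coefs (star (@Delta R rho al) h) (linmul al (linmul (oconj al) c)).
Proof.
move=> hc; apply: (star_coefs (@Delta_coefs al) hc).
  exact/admissible_linmul/admissible_linmul/(has_coefs_admissible hc).
have -> : linmul al (linear_coefs (oconj al)) = fun k =>
    match k with
    | 0 => al *o oconj al | 1 => - oconj al - al | 2 => oreal 1 | _ => 0
    end.
  apply/funext => -[|[|[|k]]]; rewrite /linmul /linear_coefs !fctE /monomial_coefs /=.
  - by rewrite !add0r omulNr opprK.
  - by rewrite add0r addr0 omulo1.
  - by rewrite !addr0 omulo0 subr0.
  - by rewrite !addr0 omulo0 subr0.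
move=> [|[|k]]; rewrite big_ord_recl /linmul /=.
- by rewrite big_ord0 !add0r addr0 omulNr opprK omul_oconjA.
- rewrite big_ord_recl big_ord0 /bump /= subn0 subn1 add0r addr0.
  by rewrite omul_oconjA omulDl !omulNl omulBr opprB addrCA.
- rewrite !big_ord_recl /bump /= big1 => [|i _]; last by rewrite omul0o.
  rewrite subn0 subn1 addr0 oreal1_mul.
  rewrite omul_oconjA omulDl !omulNl omulBr opprB addrCA !subSS subn0.
  by rewrite [_ + c k]addrC -!addrA.
Qed.

(** Both sides of the identity have coefficient sequences, so it can be tested on these:
    coefficients determine the function and conversely. *)
Lemma linear_division_coefs f g a b al x : has_coefs f a -> has_coefs g b ->
  (forall w, f w = star (linear_factor al) g w + x) <->
  a = linmul al b + monomial_coefs 0 x.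
Proof.
move=> fa gb; have rhs := has_coefsD (@star_linear al _ _ gb) (@has_coefs_cst x).
split=> [fE|aE].
  by apply: (has_coefs_unique rho_gt0 fa); rewrite (funext fE).
by move=> w; rewrite -aE in rhs; rewrite [in LHS](has_coefs_fun_unique fa rhs).
Qed.

Lemma Delta_division_coefs f h a c al x y : has_coefs f a -> has_coefs h c ->
  (forall w, f w = star (@Delta R rho al) h w + val w *o x + y) <->
  a = linmul al (linmul (oconj al) c) + monomial_coefs 1 x + monomial_coefs 0 y.
Proof.
move=> fa hc.
have rhs := has_coefsD
  (has_coefsD (@star_Delta al _ _ hc) (@has_coefs_linear x)) (@has_coefs_cst y).
split=> [fE|aE].
  by apply: (has_coefs_unique rho_gt0 fa); rewrite (funext fE).
by move=> w; rewrite -aE in rhs; rewrite [in LHS](has_coefs_fun_unique fa rhs).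
Qed.

End Star.

(** * Additivity and uniqueness of linear division *)

Section LinmulAdditive.
Context (R : realType).
Implicit Types (al x y : octonion R) (a b c : nat -> octonion R).

Lemma linmulB al a b : linmul al (a - b) = linmul al a - linmul al b.
Proof.
apply/funext => k; rewrite !fctE /linmul omulBr.
have -> : (if k is m.+1 then (a - b) m else 0) =
  (if k is m.+1 then a m else 0) - (if k is m.+1 then b m else 0).
  by case: k => [|k]; rewrite ?subr0.
by rewrite !opprD !opprK addrACA.
Qed.

(** A constant [x] in the quotient contributes [w x - al x]: the source of the linear term in the
    division by [Delta]. *)
Lemma linmulD_monomial al b x :
  linmul al (b + monomial_coefs 0 x) =
  linmul al b + monomial_coefs 1 x - monomial_coefs 0 (al *o x).
Proof.
apply/funext => -[|[|k]]; rewrite !fctE /linmul /monomial_coefs /= ?fctE /=.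
- by rewrite !sub0r addr0 omulDr opprD.
- by rewrite subr0 addr0 addrAC.
- by rewrite !addr0 subr0.
Qed.

(** Remainders are invisible at positive indices, so [linmul_eq0] applies to [b - b']; index 0 then
    compares the remainders. *)
Lemma linmul_div_unique (rho : \bar R) al b b' x x' : oball rho al ->
  admissible rho b -> admissible rho b' ->
  linmul al b + monomial_coefs 0 x = linmul al b' + monomial_coefs 0 x' ->
  b = b' /\ x = x'.
Proof.
move=> al_in adm_b adm_b' eq_b.
have bb' : b = b'.
  apply/subr0_eq/(linmul_eq0 al_in (admissibleB adm_b adm_b')) => k.
  have := congr1 (fun u => u k.+1) eq_b.
  rewrite linmulB !fctE /monomial_coefs /= !addr0 => ->.
  exact: subrr.
by split=> //; move: eq_b; rewrite bb' => /addrI /(congr1 (fun u => u 0%N)).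
Qed.

End LinmulAdditive.

(** * The two division statements for regular functions *)

Theorem lemma1 (R : realType) (rho : \bar R) (rho_gt0 : (0 < rho)%E)
    (f : oball rho -> octonion R) (f_regular : regular f)
    (alpha : octonion R) (alpha_in : oball rho alpha) :
  (exists! gr : (oball rho -> octonion R) * octonion R,
     regular gr.1 /\
     forall w : oball rho, f w = star (linear_factor alpha) gr.1 w + gr.2)
  /\
  (~ range (@oreal R) alpha ->
   exists! hab : (oball rho -> octonion R) * octonion R * octonion R,
     let: (h, a, b) := hab in
     regular h /\
     forall w : oball rho, f w = star (Delta alpha) h w + val w *o a + b).
Proof.
have [a fa] := f_regular; have adm_a := has_coefs_admissible fa.
have alc_in : oball rho (oconj alpha) by rewrite /oball /= onorm_oconj.
have [b [x [adm_b aE]]] := linmul_div alpha_in adm_a.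
split=> [|_].
  have [g gb] := admissible_has_coefs adm_b.
  exists (g, x); split=> [|[g' x'] /= [[b' gb'] fE]].
    by split; [exists b|apply/(linear_division_coefs rho_gt0 _ _ fa gb)].
  have [bb' <-] : b = b' /\ x = x'.
    apply: linmul_div_unique alpha_in adm_b (has_coefs_admissible gb') _.
    by rewrite -aE; apply/(linear_division_coefs rho_gt0 _ _ fa gb').
  by rewrite -bb' in gb'; rewrite (has_coefs_fun_unique gb gb').
have [c [y [adm_c bE]]] := linmul_div alc_in adm_b.
(* Dictionary between one quadratic division with remainder [w y' + z] and two linear ones with
   remainders [y'] and [z + alpha *o y']. *)
have twice c' y' z : linmul alpha (linmul (oconj alpha) c') +
    monomial_coefs 1 y' + monomial_coefs 0 z =
    linmul alpha (linmul (oconj alpha) c' + monomial_coefs 0 y') +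
    monomial_coefs 0 (z + alpha *o y').
  rewrite linmulD_monomial -[RHS]addrA; congr (_ + _); apply/funext => k.
  rewrite !fctE /monomial_coefs; case: ifP => _; last by rewrite oppr0 addr0.
  by rewrite addrC addrK.
have [h hc] := admissible_has_coefs adm_c.
exists (h, y, x - alpha *o y); split=> [|[[h' y'] z] [[c' hc'] fE]].
  split; first by exists c.
  by apply/(Delta_division_coefs rho_gt0 _ _ _ fa hc); rewrite twice subrK -bE.
have adm_c' := has_coefs_admissible hc'.
(* Any competing solution is read through [twice] as two linear divisions, whose uniqueness is
   applied first for [alpha], then for [oconj alpha]. *)
have [bE' xE] : b = linmul (oconj alpha) c' + monomial_coefs 0 y' /\
    x = z + alpha *o y'.
  apply: linmul_div_unique alpha_in adm_b _ _.
    have [u uc] := admissible_has_coefs (admissible_linmul (oconj alpha) adm_c').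
    exact: has_coefs_admissible (has_coefsD uc (@has_coefs_cst _ _ y')).
  by rewrite -aE -twice; apply/(Delta_division_coefs rho_gt0 _ _ _ fa hc').
have [cc' yy'] : c = c' /\ y = y'.
  by apply: linmul_div_unique alc_in adm_c adm_c' _; rewrite -bE -bE'.
rewrite -cc' in hc'.
by rewrite (has_coefs_fun_unique hc hc') xE yy' addrK.
Qed.
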